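(* Let $m,n\ge 2$ and let $A$ be a $312$-avoiding $m\times n$ $(0,1)$-matrix. (i) $A$ has at most $2(m+n-2)$ $1$'s. (ii) The maximum number of $1$'s in a $312$-avoiding $m\times n$ $(0,1)$-matrix equals $2(m+n-2)$. (iii) Every maximal $312$-avoiding $m\times n$ $(0,1)$-matrix contains exactly $2(m+n-2)$ $1$'s.
   Context: An $m\times n$ $(0,1)$-matrix $A=[a_{ij}]$ is $312$-avoiding if there do not exist rows $i_1<i_2<i_3$ and columns $j_1<j_2<j_3$ with $a_{i_1j_3}=a_{i_2j_1}=a_{i_3j_2}=1$ (i.e. $A$ has no $3\times 3$ submatrix $Q'$ with $Q'\ge \begin{bmatrix}0&0&1\\1&0&0\\0&1&0\end{bmatrix}$ entrywise). $A$ is maximal $312$-avoiding if it is $312$-avoiding and every matrix obtained from $A$ by replacing a $0$ with a $1$ is not $312$-avoiding. *)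

(* Defs.v *)
From mathcomp Require Import all_boot all_algebra.

Set Implicit Arguments.
Unset Strict Implicit.
Unset Printing Implicit Defensive.

(* A (0,1)-matrix is a matrix over bool, with true for 1 and false for 0. *)

Definition avoids312 (m n : nat) (A : 'M[bool]_(m, n)) : Prop :=
  ~ exists (i1 i2 i3 : 'I_m) (j1 j2 j3 : 'I_n),
      [/\ i1 < i2 < i3, j1 < j2 < j3 & [/\ A i1 j3, A i2 j1 & A i3 j2]].

Definition set_one (m n : nat) (A : 'M[bool]_(m, n)) (i : 'I_m) (j : 'I_n) :
    'M[bool]_(m, n) :=
  (\matrix_(k, l) (if (k == i) && (l == j) then true else A k l))%R.

Definition maximal312 (m n : nat) (A : 'M[bool]_(m, n)) : Prop :=
  avoids312 A /\
  forall (i : 'I_m) (j : 'I_n), A i j = false -> ~ avoids312 (set_one A i j).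

Definition num_ones (m n : nat) (A : 'M[bool]_(m, n)) : nat :=
  #|[set ij : 'I_m * 'I_n | A ij.1 ij.2]|.

(* Main.v *)
(* Let D (the "shadow") be the set of cells having a 1 strictly above and
   strictly to the right of them; it is closed under moving down and left.  The
   matrix avoids 312 iff no two 1's at (p, q), (p', q') with p < p', q < q'
   satisfy (p, q') \in D.
   Antidiagonals separate the 1's outside D, so there are at most m + n - 1 of
   these.  A 1 inside D that is not leftmost in its row is lowest in its column
   among the 1's of D; as D misses the top row and the last column, and the
   first column has only leftmost 1's, there are at most (m - 1) + (n - 2) 1's
   inside D.  When the matrix is maximal, both codings are onto. *)
Require Import Defs.
From mathcomp Require Import all_boot all_algebra.
From mathcomp Require Import zify.

Set Implicit Arguments.
Unset Strict Implicit.
Unset Printing Implicit Defensive.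

(** * Counting finite sets by numeric codes *)

Lemma leq_card_code (T : finType) (S : {set T}) (f : T -> nat) (k : nat) :
  {in S, forall x, f x < k} -> {in S &, injective f} -> #|S| <= k.
Proof.
move=> f_lt f_inj; rewrite cardE -(size_map f) -[leqRHS](size_iota 0).
apply: uniq_leq_size.
  by rewrite map_inj_in_uniq ?enum_uniq // => x y; rewrite !mem_enum; apply: f_inj.
by move=> y /mapP[x xS ->]; rewrite mem_iota f_lt // -mem_enum.
Qed.

Lemma geq_card_code (T : finType) (S : {set T}) (f : T -> nat) (k : nat) :
  (forall s, s < k -> exists2 x, x \in S & f x = s) -> k <= #|S|.
Proof.
move=> f_onto; rewrite cardE -(size_map f) -[leqLHS](size_iota 0).
apply: uniq_leq_size; first exact: iota_uniq.
move=> s; rewrite mem_iota => /f_onto[x xS <-].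
by rewrite map_f ?mem_enum.
Qed.

(** * The shadow, and the obstructions to adding a 1 *)

Section Shadow.
Variables m n : nat.
Implicit Types A : 'M[bool]_(m, n).

Definition shadow A (i : 'I_m) (j : 'I_n) : bool :=
  [exists k : 'I_m, exists l : 'I_n, [&& k < i, j < l & A k l]].

Lemma shadowP A (i : 'I_m) (j : 'I_n) :
  reflect (exists (k : 'I_m) (l : 'I_n), [/\ k < i, j < l & A k l]) (shadow A i j).
Proof.
apply: (iffP existsP) => [[k /existsP[l /and3P[? ? ?]]]|[k [l [? ? ?]]]].
  by exists k, l.
by exists k; apply/existsP; exists l; apply/and3P.
Qed.

Lemma shadow_sw A (i i' : 'I_m) (j j' : 'I_n) :
  i <= i' -> j' <= j -> shadow A i j -> shadow A i' j'.
Proof.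
move=> ii' jj' /shadowP[k [l [ki jl Akl]]]; apply/shadowP; exists k, l.
by split=> //; lia.
Qed.

Lemma one_shadow A (i i' : 'I_m) (j j' : 'I_n) :
  A i j -> i < i' -> j' < j -> shadow A i' j'.
Proof. by move=> Aij ? ?; apply/shadowP; exists i, j. Qed.

Lemma avoids_chain A (p p' : 'I_m) (q q' : 'I_n) :
  avoids312 A -> A p q -> A p' q' -> p < p' -> q < q' -> ~~ shadow A p q'.
Proof.
move=> avA Apq Apq' pp' qq'; apply/shadowP => -[k [l [kp ql Akl]]].
by apply: avA; exists k, p, p', q, q', l; split; [lia | lia | split].
Qed.

(** A boolean form lets a pattern be extracted constructively when avoidance fails, and lets a
    matrix with the most 1's be selected among the avoiding ones. *)
Definition avoids312b A : bool :=
  [forall p, forall p', forall q, forall q',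
    [&& A p q, A p' q', p < p' & q < q'] ==> ~~ shadow A p q'].

Lemma avoids312bP A : reflect (avoids312 A) (avoids312b A).
Proof.
apply: (iffP idP) => [avA|avA].
  move=> [i1 [i2 [i3 [j1 [j2 [j3 [/andP[i12 i23] /andP[j12 j23] [A1 A2 A3]]]]]]]].
  move: avA => /forallP/(_ i2)/forallP/(_ i3)/forallP/(_ j1)/forallP/(_ j2).
  by rewrite A2 A3 i23 j12 (one_shadow A1).
do 4![apply/forallP => ?]; apply/implyP => /and4P[A2 A3 ? ?].
exact: avoids_chain avA A2 A3 _ _.
Qed.

Lemma not_avoids312 A : ~ avoids312 A ->
  exists (i1 i2 i3 : 'I_m) (j1 j2 j3 : 'I_n),
    [/\ i1 < i2 < i3, j1 < j2 < j3 & [/\ A i1 j3, A i2 j1 & A i3 j2]].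
Proof.
move/avoids312bP; rewrite negb_forall => /existsP[i2].
rewrite negb_forall => /existsP[i3]; rewrite negb_forall => /existsP[j1].
rewrite negb_forall => /existsP[j2].
rewrite negb_imply negbK => /andP[/and4P[A2 A3 i23 j12]].
move=> /shadowP[i1 [j3 [i12 j23 A1]]]; exists i1, i2, i3, j1, j2, j3.
by rewrite i12 i23 j12 j23.
Qed.

(** The added 1 is an entry of the pattern it creates; the other two entries lie in other rows, so
    they come from [A]. The cases are the new 1 as top, middle or bottom entry; in the last two,
    [shadow] records the old top entry. *)
Lemma maximal_blocked A (i : 'I_m) (j : 'I_n) :
  maximal312 A -> ~~ A i j ->
  [\/ exists (p p' : 'I_m) (q q' : 'I_n),
        [/\ i < p < p', q < q' < j, A p q & A p' q'],
      exists (p : 'I_m) (q : 'I_n), [/\ i < p, j < q, A p q & shadow A i q]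
    | exists (p : 'I_m) (q : 'I_n), [/\ p < i, q < j, A p q & shadow A p j]].
Proof.
move=> [avA maxA] /negbTE Aij.
have old (k : 'I_m) (l : 'I_n) : set_one A i j k l -> k != i -> A k l.
  by rewrite mxE => H /negbTE ki; rewrite ki in H.
have neq (x y : 'I_m) : (x : nat) <> y -> x != y.
  by move=> xy; apply/eqP => e; apply: xy; rewrite e.
have [i1 [i2 [i3 [j1 [j2 [j3 [ltI ltJ [B1 B2 B3]]]]]]]] :=
  not_avoids312 (maxA _ _ Aij).
have [/andP[i12 i23] /andP[j12 j23]] := (ltI, ltJ).
have [/andP[/eqP e1 /eqP e2]|N1] := boolP ((i1 == i) && (j3 == j)).
  subst i j; constructor 1; exists i2, i3, j1, j2.
  by split=> //; [apply: old B2 _ | apply: old B3 _]; apply: neq; lia.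
have A1 : A i1 j3 by move: B1; rewrite mxE (negbTE N1).
have [/andP[/eqP e1 /eqP e2]|N2] := boolP ((i2 == i) && (j1 == j)).
  subst i j; constructor 2; exists i3, j2.
  by split=> //; [apply: old B3 _; apply: neq; lia | apply: one_shadow A1 _ _].
have A2 : A i2 j1 by move: B2; rewrite mxE (negbTE N2).
have [/andP[/eqP e1 /eqP e2]|N3] := boolP ((i3 == i) && (j2 == j)).
  by subst i j; constructor 3; exists i2, j1; split=> //; apply: one_shadow A1 _ _.
have A3 : A i3 j2 by move: B3; rewrite mxE (negbTE N3).
by case: avA; exists i1, i2, i3, j1, j2, j3.
Qed.

(* If adding a 1 at (i, j) does not enlarge the shadow, the new 1 cannot play
   the role of the 3 in a 312 pattern. *)
Lemma maximal_blocked_sw A (i : 'I_m) (j : 'I_n) :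
  maximal312 A ->
  (forall (p : 'I_m) (q : 'I_n), i < p -> q < j -> shadow A p q) -> ~~ A i j ->
  (exists (p : 'I_m) (q : 'I_n), [/\ i < p, j < q, A p q & shadow A i q]) \/
  (exists (p : 'I_m) (q : 'I_n), [/\ p < i, q < j, A p q & shadow A p j]).
Proof.
move=> maxA sw NA; have [] := maximal_blocked maxA NA; [|by left|by right].
move=> [p [p' [q [q' [/andP[ip pp'] /andP[qq' q'j] Apq Apq']]]]].
have := avoids_chain maxA.1 Apq Apq' pp' qq'.
by rewrite sw.
Qed.

(** All cells southwest of a shadow cell are already in the shadow, so a 1 added there does not
    enlarge it. *)
Lemma maximal_blocked_shadow A (i : 'I_m) (j : 'I_n) :
  maximal312 A -> shadow A i j -> ~~ A i j ->
  (exists (p : 'I_m) (q : 'I_n), [/\ i < p, j < q, A p q & shadow A i q]) \/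
  (exists (p : 'I_m) (q : 'I_n), [/\ p < i, q < j, A p q & shadow A p j]).
Proof.
move=> maxA sh; apply: maximal_blocked_sw => // p q ip qj.
by apply: shadow_sw sh; apply: ltnW.
Qed.

(** * Separating the 1's outside the shadow and those inside it *)

Definition outer A : {set 'I_m * 'I_n} :=
  [set ij | A ij.1 ij.2 && ~~ shadow A ij.1 ij.2].

Definition inner A : {set 'I_m * 'I_n} :=
  [set ij | A ij.1 ij.2 && shadow A ij.1 ij.2].

Lemma num_ones_split A : num_ones A = #|outer A| + #|inner A|.
Proof.
rewrite addnC -[LHS](cardsID (inner A)); congr (_ + _); apply: eq_card => x.
  by rewrite !inE; case: (A _ _); case: (shadow _ _ _).
by rewrite !inE; case: (A _ _); case: (shadow _ _ _).
Qed.

Lemma outer_inj A :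
  {in outer A &, injective (fun ij : 'I_m * 'I_n => ij.1 + ij.2)}.
Proof.
(* Of two cells with the same coordinate sum, the lower is further left, so a 1 in the upper one
   puts it in the shadow. *)
suff lt (i i' : 'I_m) (j j' : 'I_n) :
    A i j -> ~~ shadow A i' j' -> i + j = i' + j' -> ~~ (i < i').
  move=> [i j] [i' j']; rewrite !inE /= => /andP[Aij Sij] /andP[Aij' Sij'] e.
  have := lt _ _ _ _ Aij Sij' e; have := lt _ _ _ _ Aij' Sij (esym e).
  by move=> ? ?; congr (_, _); apply: val_inj => /=; lia.
move=> Aij /negP NS e; apply/negP => ii'; apply: NS.
by apply: (one_shadow Aij) => //; lia.
Qed.

Lemma card_outer_le A : #|outer A| <= (m + n).-1.
Proof.
apply: (leq_card_code (f := fun ij : 'I_m * 'I_n => ij.1 + ij.2)).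
  by move=> [i j] _ /=; have := (ltn_ord i, ltn_ord j) => -[]; lia.
exact: outer_inj.
Qed.

(** Either obstruction left by [maximal_blocked_sw] gives a shadow cell to the right of (i, j) in
    its row or above it in its column, which would force (i, j) into the shadow. *)
Lemma maximal_rim A (i : 'I_m) (j : 'I_n) :
  maximal312 A -> ~~ shadow A i j ->
  (forall (p : 'I_m) (q : 'I_n), i < p -> q < j -> shadow A p q) -> A i j.
Proof.
move=> maxA NS sw; apply/negPn/negP => NA; move/negP: NS; apply.
case: (maximal_blocked_sw maxA sw NA) => -[p [q [ip jq Apq sh]]].
  by apply: shadow_sw sh => //; lia.
by apply: shadow_sw sh => //; lia.
Qed.

Definition leftmost A (i : 'I_m) (j : 'I_n) : bool :=
  [forall q : 'I_n, (q < j) ==> ~~ A i q].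

Lemma leftmostP A (i : 'I_m) (j : 'I_n) :
  reflect (forall q : 'I_n, q < j -> ~~ A i q) (leftmost A i j).
Proof. exact: 'forall_implyP. Qed.

Lemma leftmostPn A (i : 'I_m) (j : 'I_n) :
  reflect (exists2 q : 'I_n, q < j & A i q) (~~ leftmost A i j).
Proof.
rewrite negb_forall; apply: (iffP existsP) => [[q]|[q qj Aq]].
  by rewrite negb_imply negbK => /andP[]; exists q.
by exists q; rewrite negb_imply negbK qj.
Qed.

Lemma leftmost_uniq A i (j j' : 'I_n) :
  A i j -> A i j' -> leftmost A i j -> leftmost A i j' -> j = j'.
Proof.
move=> Aj Aj' /leftmostP L /leftmostP L'; apply: val_inj => /=.
case: (ltngtP j j') => // jj'; first by have := L' _ jj'; rewrite Aj.
by have := L _ jj'; rewrite Aj'.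
Qed.

(* Such a 1 is lowest in its column among the 1's of the shadow. *)
Lemma nonleftmost_uniq A (i i' : 'I_m) j :
  avoids312 A -> A i j -> A i' j -> shadow A i j -> shadow A i' j ->
  ~~ leftmost A i j -> ~~ leftmost A i' j -> i = i'.
Proof.
suff lt (p p' : 'I_m) : avoids312 A -> A p' j -> shadow A p j ->
    ~~ leftmost A p j -> ~~ (p < p').
  move=> avA Ai Ai' S S' L L'; apply: val_inj => /=.
  by have := lt _ _ avA Ai' S L; have := lt _ _ avA Ai S' L'; lia.
move=> avA Ap' S /leftmostPn[q qj Aq]; apply/negP => pp'.
by have := avoids_chain avA Aq Ap' pp' qj; rewrite S.
Qed.

Lemma num_ones_set_one A i j :
  A i j = false -> num_ones A < num_ones (set_one A i j).
Proof.
move=> Aij; apply: proper_card; apply/properP; split.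
  by apply/subsetP => x; rewrite !inE mxE => ->; rewrite if_same.
by exists (i, j); rewrite inE /= ?mxE ?eqxx ?Aij.
Qed.

(** An avoiding matrix with the most 1's is maximal; it will show that the bound is attained. *)
Lemma maximal_exists : exists A, maximal312 A.
Proof.
have av0 : avoids312b (\matrix_(i < m, j < n) false)%R.
  by apply/avoids312bP => -[? [? [? [? [? [? [_ _ []]]]]]]]; rewrite mxE.
case: (arg_maxnP (@num_ones m n) av0) => A /avoids312bP avA maxA; exists A.
split=> // i j Aij /avoids312bP/maxA le_max.
by have := leq_trans (num_ones_set_one Aij) le_max; rewrite ltnn.
Qed.

End Shadow.

(** * The two counts, for dimensions at least 2 *)

Section Count.
Variables M N : nat.
Local Notation m := M.+2.
Local Notation n := N.+2.
Implicit Types A : 'M[bool]_(m, n).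

Lemma shadow_bounds A (i : 'I_m) (j : 'I_n) : shadow A i j -> 0 < i /\ j < N.+1.
Proof. by move=> /shadowP[k [l [ki jl _]]]; have := ltn_ord l; lia. Qed.

(* Leftmost 1's use the codes 0 .. M, the others the codes M + 1 .. M + N. *)
Definition inner_code A (ij : 'I_m * 'I_n) : nat :=
  if leftmost A ij.1 ij.2 then ij.1.-1 else M + ij.2.

Lemma nonleftmost_pos A (i : 'I_m) (j : 'I_n) : ~~ leftmost A i j -> 0 < j.
Proof. by move=> /leftmostPn[q qj _]; lia. Qed.

Lemma card_inner_le A : avoids312 A -> #|inner A| <= (M + N).+1.
Proof.
move=> avA; apply: (leq_card_code (f := inner_code A)).
  move=> [i j]; rewrite inE /inner_code /= => /andP[_ /shadow_bounds[? ?]].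
  by case: ifP => _; have := ltn_ord i; lia.
move=> [i j] [i' j']; rewrite !inE /inner_code /= => /andP[Aij S] /andP[Aij' S'].
have [[i0 jN] [i0' jN']] := (shadow_bounds S, shadow_bounds S').
have := (ltn_ord i, ltn_ord i') => -[im im'].
case: ifPn => L; case: ifPn => L' e.
- have ii' : i = i' by apply: val_inj => /=; lia.
  by subst i'; rewrite (leftmost_uniq Aij Aij' L L').
(* A 1 that is not leftmost has a positive column, so its code exceeds M, while leftmost codes are
   at most M. *)
- by have := nonleftmost_pos L'; lia.
- by have := nonleftmost_pos L; lia.
- have jj' : j = j' by apply: val_inj => /=; lia.
  by subst j'; rewrite (nonleftmost_uniq avA Aij Aij' S S' L L').
Qed.

Lemma card_outer_maximal A : maximal312 A -> #|outer A| = M + N + 3.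
Proof.
move=> maxA; apply/eqP; rewrite eqn_leq; apply/andP; split.
  by apply: leq_trans (card_outer_le A) _; lia.
apply: (geq_card_code (f := fun ij : 'I_m * 'I_n => ij.1 + ij.2)) => s s_lt.
(* On antidiagonal [s], the lowest cell outside the shadow will hold a 1. The first two conditions
   keep the subtraction and [inord] from truncating. *)
pose P (i : 'I_m) := [&& i <= s, s - i < n & ~~ shadow A i (inord (s - i))].
(* The top end of the antidiagonal, in row 0 or in the last column, is never in the shadow. *)
have P0 : P (inord (s - N.+1)).
  rewrite /P /= inordK; last by lia.
  apply/and3P; split; [by lia | by lia | apply/negP => /shadow_bounds].
  by rewrite !inordK; lia.
case: (arg_maxnP (fun i : 'I_m => (i : nat)) P0) => i /and3P[i_s sin NS] maxi.
pose j : 'I_n := inord (s - i).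
have jE : j = s - i :> nat by rewrite /j inordK.
exists (i, j); last by rewrite /= jE; lia.
rewrite inE /= NS andbT; apply: maximal_rim => // p q ip qj.
have ltp := ltn_ord p.
have iS : (inord i.+1 : 'I_m) = i.+1 :> nat by rewrite inordK //; lia.
have jS : (inord (s - i.+1) : 'I_n) = s - i.+1 :> nat by rewrite inordK //; lia.
(* The next cell down the antidiagonal is in the shadow by the choice of [i], and (p, q) is weakly
   southwest of it. *)
apply: (@shadow_sw _ _ _ (inord i.+1) _ (inord (s - i.+1))).
- by rewrite iS.
- by rewrite jS; lia.
have [//|NS'] := boolP (shadow A (inord i.+1) (inord (s - i.+1))).
have : P (inord i.+1) by rewrite /P iS NS' andbT; apply/andP; split; lia.
by move/maxi; rewrite iS; lia.
Qed.

(** No obstruction fits at row 0, column 1, so maximality forces a 1 there, and this 1 casts the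
    shadow. *)
Lemma maximal_shadow_col0 A (i : 'I_m) :
  maximal312 A -> 0 < i -> shadow A i ord0.
Proof.
move=> maxA i0; pose j1 : 'I_n := inord 1.
have j1E : j1 = 1 :> nat by rewrite inordK.
suff A1 : A ord0 j1 by apply: (one_shadow A1) => //; rewrite j1E.
apply/negPn/negP => NA; case: (maximal_blocked maxA NA).
- by move=> [p [p' [q [q' []]]]]; lia.
- by move=> [p [q [_ _ _ /shadow_bounds[]]]].
- by move=> [p [q []]].
Qed.

(** Likewise, a 1 is forced in the last column of the last row but one. *)
Lemma maximal_shadow_last_row A (j : 'I_n) :
  maximal312 A -> j < N.+1 -> shadow A ord_max j.
Proof.
move=> maxA jN; pose i1 : 'I_m := inord M.
have i1E : i1 = M :> nat by rewrite inordK.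
suff A1 : A i1 ord_max by apply: (one_shadow A1) => //=; rewrite i1E.
apply/negPn/negP => NA; case: (maximal_blocked maxA NA).
- by move=> [p [p' [q [q' []]]]]; have := ltn_ord p'; lia.
- by move=> [p [q []]]; have := ltn_ord q; rewrite /=; lia.
- by move=> [p [q [_ _ _ /shadow_bounds[_]]]]; rewrite /= ltnn.
Qed.

Lemma maximal_corner A : maximal312 A -> A ord_max ord0.
Proof.
move=> maxA; apply/negPn/negP => NA.
have S := maximal_shadow_col0 maxA (ltn0Sn _ : 0 < (ord_max : 'I_m)).
case: (maximal_blocked_shadow maxA S NA) => -[p [q []]] //=.
by have := ltn_ord p; lia.
Qed.

Lemma maximal_row A (p : 'I_m) : maximal312 A -> 0 < p ->
  exists q, [/\ A p q, shadow A p q & leftmost A p q].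
Proof.
move=> maxA p0.
(* Take the rightmost shadow cell of row [p] with a 1 at or below it. If it held a 0, an obstruction
   to the lower right would give a cell further right, and one to the upper left would form a 312
   pattern with that 1. *)
pose P (q : 'I_n) := shadow A p q && [exists p' : 'I_m, (p <= p') && A p' q].
have P0 : P ord0.
  rewrite /P maximal_shadow_col0 //=; apply/existsP; exists ord_max.
  by rewrite maximal_corner // andbT -ltnS ltn_ord.
case: (arg_maxnP (fun q : 'I_n => (q : nat)) P0) => q.
move=> /andP[S /existsP[p' /andP[pp' Ap']]] maxq.
have Apq : A p q.
  apply/negPn/negP => NA.
  case: (maximal_blocked_shadow maxA S NA) => -[p1 [q1 [ltp ltq A1 S1]]].
    suff /maxq : P q1 by lia.
    by rewrite /P S1; apply/existsP; exists p1; rewrite A1 andbT ltnW.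
  have := avoids_chain maxA.1 A1 Ap' (leq_trans ltp pp') ltq.
  by rewrite S1.
case: (arg_minnP (fun q : 'I_n => (q : nat)) (Apq : (A p) q)) => q0 A0 min0.
(* The leftmost 1 of the row is weakly left of [q], so it is in the shadow too. *)
exists q0; split=> //; first by apply: shadow_sw S => //; apply: min0.
by apply/leftmostP => q1 lt1; apply/negP => /min0; lia.
Qed.

Lemma maximal_column A (q : 'I_n) : maximal312 A -> 0 < q < N.+1 ->
  exists p, [/\ A p q, shadow A p q & ~~ leftmost A p q].
Proof.
move=> maxA /andP[q0 qN].
(* Dually, take the highest shadow cell of column [q] with a 1 to its left. Now the lower right
   obstruction forms a pattern with that 1, and the upper left one gives a higher cell. *)
pose P (p : 'I_m) := shadow A p q && ~~ leftmost A p q.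
have P0 : P ord_max.
  rewrite /P maximal_shadow_last_row //=; apply/leftmostPn; exists ord0 => //.
  exact: maximal_corner.
case: (arg_minnP (fun p : 'I_m => (p : nat)) P0) => p /andP[S L] minp.
exists p; split=> //; apply/negPn/negP => NA.
case: (maximal_blocked_shadow maxA S NA) => -[p1 [q1 [ltp ltq A1 S1]]].
  have [q2 lt2 A2] := leftmostPn _ _ _ L.
  by have := avoids_chain maxA.1 A2 A1 ltp (ltn_trans lt2 ltq); rewrite S1.
suff /minp : P p1 by lia.
by rewrite /P S1; apply/leftmostPn; exists q1.
Qed.

Lemma card_inner_maximal A : maximal312 A -> #|inner A| = (M + N).+1.
Proof.
move=> maxA; apply/eqP; rewrite eqn_leq (card_inner_le maxA.1) /=.
apply: (geq_card_code (f := inner_code A)) => s s_lt.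
case: (leqP s M) => sM.
  have pE : (inord s.+1 : 'I_m) = s.+1 :> nat by rewrite inordK //; lia.
  have [|q [Apq S L]] := @maximal_row A (inord s.+1) maxA; first by rewrite pE.
  by exists (inord s.+1, q); rewrite ?inE /inner_code /= ?Apq ?L ?pE.
have qE : (inord (s - M) : 'I_n) = s - M :> nat by rewrite inordK //; lia.
have [|p [Apq S L]] := @maximal_column A (inord (s - M)) maxA.
  by rewrite qE; lia.
exists (p, inord (s - M)); first by rewrite inE /= Apq.
by rewrite /inner_code /= (negbTE L) qE; lia.
Qed.

End Count.

Theorem theorem3p5 (m n : nat) (hm : 2 <= m) (hn : 2 <= n) :
  [/\ forall A : 'M[bool]_(m, n),
        avoids312 A -> num_ones A <= 2 * (m + n - 2),
      (exists A : 'M[bool]_(m, n),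
         avoids312 A /\ num_ones A = 2 * (m + n - 2)) /\
      (forall A : 'M[bool]_(m, n),
         avoids312 A -> num_ones A <= 2 * (m + n - 2))
    & forall A : 'M[bool]_(m, n),
        maximal312 A -> num_ones A = 2 * (m + n - 2)].
Proof.
case: m hm => [|[|M]] // _; case: n hn => [|[|N]] // _.
have upper (A : 'M[bool]_(M.+2, N.+2)) :
    avoids312 A -> num_ones A <= 2 * (M.+2 + N.+2 - 2).
  move=> avA; rewrite num_ones_split.
  by have := (card_outer_le A, card_inner_le avA) => -[]; lia.
have exact_max (A : 'M[bool]_(M.+2, N.+2)) :
    maximal312 A -> num_ones A = 2 * (M.+2 + N.+2 - 2).
  move=> maxA; rewrite num_ones_split card_outer_maximal // card_inner_maximal //.
  by lia.
split=> //; split=> //.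
have [A maxA] := maximal_exists M.+2 N.+2.
by exists A; split; [exact: maxA.1 | exact: exact_max].
Qed.
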